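(* Let $\mathcal S\subseteq\mathcal U(d)$ be an ensemble with uniform distribution $\nu$ that is a unitary $t$-design with $t\ge1$, and let $C,D:\mathbb{C}^d\to\mathbb{C}^d$ be linear operators. Then $$\int_{\mathcal S}\operatorname{Tr}[WC]\operatorname{Tr}[W^\dagger D]\,d\nu(W)=\int_{\mathcal U(d)}\operatorname{Tr}[WC]\operatorname{Tr}[W^\dagger D]\,d\mu(W)=\frac1d\operatorname{Tr}[CD].$$
   Context: $\mathcal U(d)$ is the group of $d\times d$ unitary matrices and $\mu$ its normalized Haar measure. An ensemble $\mathcal S\subseteq\mathcal U(d)$ with uniform distribution $\nu$ is a unitary $t$-design if $\int_{\mathcal S}P(S)\,d\nu(S)=\int_{\mathcal U(d)}P(U)\,d\mu(U)$ for every polynomial $P$ of degree at most $t$ in the matrix entries of $U$ and at most $t$ in those of $U^\dagger$. *)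

(* Defs.v *)
From HB Require Import structures.
From mathcomp Require Import all_boot all_order all_algebra.
From mathcomp Require Import complex.
From mathcomp Require Import all_classical all_reals all_analysis.
(* the notations of mpoly are incompatible with those of all_analysis *)
From mathcomp Require Import -(notations) mpoly.

Set Implicit Arguments.
Unset Strict Implicit.
Unset Printing Implicit Defensive.

Import Order.TTheory GRing.Theory Num.Theory numFieldNormedType.Exports.

Local Open Scope classical_set_scope.
Local Open Scope sesquilinear_scope.
Local Open Scope complex_scope.
Local Open Scope ring_scope.

(* Complex d x d matrices with the Borel sigma-algebra. Only the regular
   algebra R[i]^o (convertible to R[i]) carries the norm topology of the
   complex numbers, hence the ^o. *)
Definition borel_mx (R : realType) (d : nat) :=
  g_sigma_algebraType (@open 'M[R[i]^o]_d).

Definition unitary_group (R : realType) (d : nat) : set (borel_mx R d) :=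
  [set U | (U : 'M[R[i]]_d) \is unitarymx].

(* The library only integrates real and extended-real functions. *)
Definition cintegral (R : realType) (disp : measure_display)
    (T : measurableType disp) (mu : {measure set T -> \bar R})
    (A : set T) (f : T -> R[i]) : R[i] :=
  (\int[mu]_(x in A) complex.Re (f x)) +i* (\int[mu]_(x in A) complex.Im (f x)).

(* Measures on U(d) (and on subsets of U(d)) are represented by Borel measures
   on all matrices that give full mass to U(d) (resp. to the subset). The
   normalized Haar measure is the left-invariant Borel probability measure; as
   U(d) is compact, it is unique and also right-invariant. *)
Definition normalized_haar (R : realType) (d : nat)
    (mu : probability (borel_mx R d) R) : Prop :=
  mu (@unitary_group R d) = 1%E /\
  forall (V : 'M[R[i]]_d) (A : set (borel_mx R d)),
    V \is unitarymx -> measurable A -> A `<=` @unitary_group R d ->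
    mu ((fun W : 'M[R[i]]_d => V *m W) @` A) = mu A.

(* Full mass on S and equal mass on all points of S. For a finite S this is
   exactly the normalized counting measure; for an infinite S, where "uniform"
   has no canonical meaning, it only says that no point of S is an atom. *)
Definition uniform_on (R : realType) (d : nat)
    (nu : probability (borel_mx R d) R) (S : set (borel_mx R d)) : Prop :=
  nu S = 1%E /\ forall U V, S U -> S V -> nu [set U] = nu [set V].

(* Polynomials in 2 d^2 variables: the first d^2 stand for the entries of U,
   the last d^2 for those of its adjoint, both listed in mxvec order. *)
Definition bidegree_le (R : realType) (d t : nat)
    (P : mpoly (d * d + d * d) R[i]) : Prop :=
  forall m : multinom (d * d + d * d), m \in msupp P ->
    (\sum_(k < d * d) m (lshift (d * d) k) <= t)%N /\
    (\sum_(k < d * d) m (rshift (d * d) k) <= t)%N.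

Definition eval_adj (R : realType) (d : nat)
    (P : mpoly (d * d + d * d) R[i]) (U : 'M[R[i]]_d) : R[i] :=
  meval (row_mx (mxvec U) (mxvec (U ^t*)) 0) P.

Definition unitary_design (R : realType) (d t : nat)
    (mu nu : probability (borel_mx R d) R) (S : set (borel_mx R d)) : Prop :=
  forall P : mpoly (d * d + d * d) R[i], bidegree_le t P ->
    cintegral nu S (eval_adj P) =
    cintegral mu (@unitary_group R d) (eval_adj P).

(* Main.v *)
Require Import Defs.
From HB Require Import structures.
From mathcomp Require Import all_boot all_order all_algebra.
From mathcomp Require Import complex.
From mathcomp Require Import all_classical all_reals all_analysis.
From mathcomp Require Import -(notations) mpoly.
From mathcomp Require Import measurable_realfun.

(* Expanding the traces reduces the Haar integral to the moments
   E[W i j * conj (W k l)], which only left invariance is needed to compute.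
   Flipping the sign of row i gives the opposite value when i != k, so these
   moments vanish; swapping rows i and k shows that E[W i j * conj (W i l)] does
   not depend on i; and the sum over i is the (l, j) entry of W^t* W = 1. Hence
   the moment is 1/d if i = k and j = l, and 0 otherwise. *)

Set Implicit Arguments.
Unset Strict Implicit.
Unset Printing Implicit Defensive.

Import Order.TTheory GRing.Theory Num.Theory numFieldNormedType.Exports.

Local Open Scope classical_set_scope.
Local Open Scope sesquilinear_scope.
Local Open Scope complex_scope.
Local Open Scope ring_scope.

(** * Continuity in the entrywise matrix topology *)

Lemma mx_coord_continuous (T : topologicalType) (m n : nat) (i : 'I_m)
    (j : 'I_n) : continuous (fun M : 'M[T]_(m, n) => M i j).
Proof.
move=> M A MA.
exists (fun k l => if (k == i) && (l == j) then A else setT).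
  by move=> k l; case: ifP => [/andP[/eqP-> /eqP->]//|_]; exact: filterT.
by move=> N /(_ i j); rewrite !eqxx.
Qed.

(** A neighbourhood of a matrix contains a product of neighbourhoods of its entries, and filters are
    closed under finite intersections. *)
Lemma continuous_mx (S T : topologicalType) (m n : nat)
    (f : S -> 'M[T]_(m, n)) :
  (forall i j, continuous (fun x => f x i j)) -> continuous f.
Proof.
move=> cf x A [P fP PA]; apply: filterS.
  by move=> y; apply: PA.
apply: filter_forall => i; apply: filter_forall => j.
exact: cf (fP i j).
Qed.

Lemma continuous_mulmx (K : numFieldType) (m n p : nat) (V : 'M[K]_(m, n)) :
  continuous (fun W : 'M[K^o]_(n, p) => (V *m W : 'M[K^o]_(m, p))).
Proof.
apply: continuous_mx => i j.
(* Each entry of the product is a finite sum of coordinates scaled by constants; [*:] on [K^o] makes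
   continuity of scaling applicable. *)
rewrite (_ : (fun _ => _) =
  fun W : 'M[K^o]_(n, p) => \sum_k V i k *: (W k j : K^o)); last first.
  by apply/funext => W; rewrite mxE.
apply: continuous_big => [|k _]; first exact: add_continuous.
move=> W; apply: cvgZl_tmp; first exact: (nbhs_filter W).
exact: (@mx_coord_continuous K^o).
Qed.

(** * Real and imaginary parts of complex numbers *)

Lemma complex_ReD (R : rcfType) (x y : R[i]) :
  complex.Re (x + y) = complex.Re x + complex.Re y.
Proof. by case: x y => [? ?] []. Qed.

Lemma complex_ImD (R : rcfType) (x y : R[i]) :
  complex.Im (x + y) = complex.Im x + complex.Im y.
Proof. by case: x y => [? ?] []. Qed.

Lemma complex_ReM (R : rcfType) (x y : R[i]) : complex.Re (x * y) =
  complex.Re x * complex.Re y - complex.Im x * complex.Im y.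
Proof. by case: x y => [? ?] []. Qed.

Lemma complex_ImM (R : rcfType) (x y : R[i]) : complex.Im (x * y) =
  complex.Re x * complex.Im y + complex.Im x * complex.Re y.
Proof. by case: x y => [? ?] []. Qed.

Lemma complex_Re_conj (R : rcfType) (z : R[i]) :
  complex.Re (Num.conj z) = complex.Re z.
Proof. by case: z. Qed.

Lemma complex_Im_conj (R : rcfType) (z : R[i]) :
  complex.Im (Num.conj z) = - complex.Im z.
Proof. by case: z. Qed.

Lemma normc_ge_Im (R : rcfType) (x : R[i]) : `|complex.Im x|%:C <= `|x|.
Proof. by rewrite normc_def lecR -sqrtr_sqr ler_wsqrtr// lerDr sqr_ge0. Qed.

(** An additive map dominated by the norm is 1-Lipschitz, so the radius [e] serves on both sides. *)
Lemma continuous_normc_le (R : realType) (f : R[i] -> R) :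
  {morph f : x y / x - y} -> (forall x, `|f x|%:C <= `|x|) ->
  continuous (f : R[i]^o -> R).
Proof.
move=> fB f_le z A /nbhs_ballP[e /= e0 eA]; apply/nbhs_ballP.
exists e%:C => /=; first by rewrite ltcR.
move=> w; rewrite -ball_normE /= => zw; apply: eA; rewrite -ball_normE /=.
by rewrite -ltcR -fB; exact: le_lt_trans (f_le _) zw.
Qed.

Lemma continuous_Re (R : realType) : continuous (@complex.Re R : R[i]^o -> R).
Proof.
by apply: (@continuous_normc_le R (@complex.Re R)) (@normc_ge_Re R) => -[? ?] [].
Qed.

Lemma continuous_Im (R : realType) : continuous (@complex.Im R : R[i]^o -> R).
Proof.
by apply: (@continuous_normc_le R (@complex.Im R)) (@normc_ge_Im R) => -[? ?] [].
Qed.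

(** * Borel measurability on the space of matrices *)

Section borel_mx.
Variables (R : realType) (d : nat).

Lemma open_borel_mx (A : set 'M[R[i]^o]_d) :
  open A -> measurable (A : set (borel_mx R d)).
Proof. exact: sub_sigma_algebra. Qed.

(** Open intervals generate the Borel sets of the reals, and their preimages are open. *)
Lemma continuous_borel_mx (f : 'M[R[i]^o]_d -> R) :
  continuous f -> measurable_fun [set: borel_mx R d] f.
Proof.
move=> /continuousP cf.
apply: (measurability _ (RGenOpens.measurableE R)) => _ [_ [x [y ->]] <-].
by rewrite setTI; have /cf/open_borel_mx : open `]x, y[%classic
  by exact: interval_open.
Qed.

Lemma measurable_mulmx (V : 'M[R[i]]_d) :
  measurable_fun [set: borel_mx R d]
    ((fun W : 'M[R[i]]_d => V *m W) : borel_mx R d -> borel_mx R d).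
Proof.
apply: (@measurability _ _ (borel_mx R d) (borel_mx R d) setT _
  (@open 'M[R[i]^o]_d) erefl) => _ [A oA <-].
rewrite setTI; apply: open_borel_mx.
by move/continuousP: (@continuous_mulmx R[i] d d d V); apply.
Qed.

Lemma measurable_Re_coord i j : measurable_fun [set: borel_mx R d]
  (fun W : 'M[R[i]]_d => complex.Re (W i j)).
Proof.
apply: continuous_borel_mx => W.
exact: (continuous_comp (@mx_coord_continuous R[i]^o d d i j W)
  (@continuous_Re R _)).
Qed.

Lemma measurable_Im_coord i j : measurable_fun [set: borel_mx R d]
  (fun W : 'M[R[i]]_d => complex.Im (W i j)).
Proof.
apply: continuous_borel_mx => W.
exact: (continuous_comp (@mx_coord_continuous R[i]^o d d i j W)
  (@continuous_Im R _)).
Qed.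

End borel_mx.

(** * Linearity of the complex integral *)

Section cintegral.
Variables (R : realType) (disp : measure_display) (T : measurableType disp).
Variables (mu : {measure set T -> \bar R}) (A : set T).
Hypothesis mA : measurable A.
Implicit Types f g : T -> R[i].

Definition cintegrable f :=
  mu.-integrable A (EFin \o (fun x => complex.Re (f x))) /\
  mu.-integrable A (EFin \o (fun x => complex.Im (f x))).

Lemma integrable_EFinZl (k : R) (f : T -> R) :
  mu.-integrable A (EFin \o f) -> mu.-integrable A (EFin \o (fun x => k * f x)).
Proof. by move=> fi; exact: (integrableZl mA k fi). Qed.

Lemma integrable_EFinD (f g : T -> R) :
  mu.-integrable A (EFin \o f) -> mu.-integrable A (EFin \o g) ->
  mu.-integrable A (EFin \o (fun x => f x + g x)).
Proof. by move=> fi gi; exact: (integrableD mA fi gi). Qed.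

Lemma integrable_EFinB (f g : T -> R) :
  mu.-integrable A (EFin \o f) -> mu.-integrable A (EFin \o g) ->
  mu.-integrable A (EFin \o (fun x => f x - g x)).
Proof. by move=> fi gi; exact: (integrableB mA fi gi). Qed.

Lemma eq_cintegral g f : {in A, f =1 g} -> cintegral mu A f = cintegral mu A g.
Proof.
by move=> fg; congr (_ +i* _); apply: eq_Rintegral => x xA; rewrite fg.
Qed.

Lemma cintegralD f g : cintegrable f -> cintegrable g ->
  cintegral mu A (fun x => f x + g x) = cintegral mu A f + cintegral mu A g.
Proof.
move=> [fr fi] [gr gi]; rewrite /cintegral.
under eq_Rintegral do rewrite complex_ReD.
under [X in _ +i* X]eq_Rintegral do rewrite complex_ImD.
by rewrite !RintegralD.
Qed.

Lemma cintegrableD f g :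
  cintegrable f -> cintegrable g -> cintegrable (fun x => f x + g x).
Proof.
move=> [fr fi] [gr gi]; split.
  under eq_fun do rewrite complex_ReD; exact: integrable_EFinD.
under eq_fun do rewrite complex_ImD; exact: integrable_EFinD.
Qed.

Lemma cintegrableZ (a : R[i]) f :
  cintegrable f -> cintegrable (fun x => a * f x).
Proof.
move=> [fr fi]; split.
  under eq_fun do rewrite complex_ReM.
  by apply: integrable_EFinB; exact: integrable_EFinZl.
under eq_fun do rewrite complex_ImM.
by apply: integrable_EFinD; exact: integrable_EFinZl.
Qed.

Lemma cintegralZ (a : R[i]) f : cintegrable f ->
  cintegral mu A (fun x => a * f x) = a * cintegral mu A f.
Proof.
move=> [fr fi]; rewrite /cintegral.
under eq_Rintegral do rewrite complex_ReM.
under [X in _ +i* X]eq_Rintegral do rewrite complex_ImM.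
rewrite RintegralB ?RintegralD ?RintegralZl//; try exact: integrable_EFinZl.
by case: a.
Qed.

Lemma cintegrable0 : cintegrable (fun=> 0).
Proof. by split; exact: integrable0. Qed.

Lemma cintegral0 : cintegral mu A (fun=> 0) = 0.
Proof. by rewrite /cintegral /= Rintegral_cst// mul0r. Qed.

Lemma cintegrable_sum (I : Type) (s : seq I) (f : I -> T -> R[i]) :
  (forall i, cintegrable (f i)) -> cintegrable (fun x => \sum_(i <- s) f i x).
Proof.
move=> fi; elim: s => [|i s IHs].
  by under eq_fun do rewrite big_nil; exact: cintegrable0.
by under eq_fun do rewrite big_cons; exact: cintegrableD.
Qed.

Lemma cintegral_sum (I : Type) (s : seq I) (f : I -> T -> R[i]) :
  (forall i, cintegrable (f i)) ->
  cintegral mu A (fun x => \sum_(i <- s) f i x) =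
  \sum_(i <- s) cintegral mu A (f i).
Proof.
move=> fi; elim: s => [|i s IHs].
  by under eq_fun do rewrite big_nil; rewrite big_nil cintegral0.
under eq_fun do rewrite big_cons.
by rewrite big_cons -IHs cintegralD//; exact: cintegrable_sum.
Qed.

End cintegral.

(** * Second moments of the Haar measure *)

Definition entry_prod (R : realType) (d : nat) (i j k l : 'I_d)
    (W : 'M[R[i]]_d) : R[i] := W i j * Num.conj (W k l).

Section haar.
Variables (R : realType) (d : nat).

Lemma measurable_Re_entry_prod (i j k l : 'I_d) :
  measurable_fun [set: borel_mx R d]
    (fun W : 'M[R[i]]_d => complex.Re (entry_prod i j k l W)).
Proof.
under eq_fun do rewrite complex_ReM complex_Re_conj complex_Im_conj mulrN opprK.
by apply: measurable_funD; apply: measurable_funM;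
  (exact: measurable_Re_coord || exact: measurable_Im_coord).
Qed.

Lemma measurable_Im_entry_prod (i j k l : 'I_d) :
  measurable_fun [set: borel_mx R d]
    (fun W : 'M[R[i]]_d => complex.Im (entry_prod i j k l W)).
Proof.
under eq_fun do rewrite complex_ImM complex_Re_conj complex_Im_conj.
apply: measurable_funD; apply: measurable_funM;
  try (exact: measurable_Re_coord || exact: measurable_Im_coord).
exact: measurableT_comp (measurable_Im_coord _ _).
Qed.

Lemma sum_entry_prod (i k : 'I_d) (W : 'M[R[i]]_d) :
  \sum_j entry_prod i j k j W = (W *m W ^t*) i k.
Proof. by rewrite mxE; apply: eq_bigr => j _; rewrite !mxE. Qed.

(** The equation [W *m W ^t* = 1] amounts to finitely many conditions on real and imaginary parts of
    entries, each the preimage of a point under a measurable function. *)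
Lemma measurable_unitary_group : measurable (@unitary_group R d).
Proof.
rewrite (_ : @unitary_group R d = \bigcap_(ik in [set: 'I_d * 'I_d])
    ((fun W => complex.Re (\sum_j entry_prod ik.1 j ik.2 j W))
       @^-1` [set (ik.1 == ik.2)%:R] `&`
     (fun W => complex.Im (\sum_j entry_prod ik.1 j ik.2 j W))
       @^-1` [set 0])); last first.
  apply/seteqP; split=> [W /unitarymxP WW [i k] _ /=|W h].
    by rewrite sum_entry_prod WW mxE; case: (i == k).
  apply/unitarymxP/matrixP => i k; have [/=] := h (i, k) I.
  rewrite sum_entry_prod (_ : 1%:M i k = (i == k)%:R); last by rewrite mxE.
  by case: (_ i k) => x y /= -> ->; case: (i == k).
apply: fin_bigcap_measurable => [|[i k] _ /=]; first exact: finite_finset.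
apply: measurableI; rewrite -[X in measurable X]setTI.
  have mf : measurable_fun [set: borel_mx R d]
      (fun W => complex.Re (\sum_j entry_prod i j k j W)).
    under eq_fun do rewrite (big_morph _ (@complex_ReD R) (erefl _)).
    by apply: measurable_sum => j; exact: measurable_Re_entry_prod.
  exact: mf.
have mf : measurable_fun [set: borel_mx R d]
    (fun W => complex.Im (\sum_j entry_prod i j k j W)).
  under eq_fun do rewrite (big_morph _ (@complex_ImD R) (erefl _)).
  by apply: measurable_sum => j; exact: measurable_Im_entry_prod.
exact: mf.
Qed.

(** The squared modulus of [W i j] is one of the nonnegative terms whose sum is the diagonal entry
    [(i, i)] of [W *m W ^t*], which is 1. *)
Lemma unitary_coord_le1 (W : 'M[R[i]]_d) i j :
  W \is unitarymx -> `|W i j| <= 1.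
Proof.
move=> /unitarymxP /matrixP /(_ i i); rewrite -sum_entry_prod !mxE eqxx => WW.
rewrite -(@expr_le1 _ 2)// normCK -[X in _ <= X]WW.
rewrite (bigD1 j)//= lerDl sumr_ge0// => k _.
by rewrite /entry_prod -normCK exprn_ge0.
Qed.

Variable mu : probability (borel_mx R d) R.

(** On the unitary group, a set of finite measure, the integrand is measurable and bounded by 1. *)
Lemma cintegrable_entry_prod (i j k l : 'I_d) :
  cintegrable mu (@unitary_group R d) (entry_prod i j k l).
Proof.
have le1 W : @unitary_group R d W -> `|entry_prod i j k l W| <= 1.
  move=> uW; rewrite normrM norm_conjC mulr_ile1//; exact: unitary_coord_le1.
have muU : (mu (@unitary_group R d) < +oo)%E.
  by apply: le_lt_trans (probability_le1 mu measurable_unitary_group) (ltry 1).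
have mU := measurable_unitary_group; split;
  apply: measurable_bounded_integrable => //.
- by apply: measurable_funTS; exact: measurable_Re_entry_prod.
- exists 1; split=> [//|M M1 W uW] /=; apply: le_trans (ltW M1).
  by rewrite -lecR; apply: le_trans (normc_ge_Re _) (le1 _ uW).
- by apply: measurable_funTS; exact: measurable_Im_entry_prod.
- exists 1; split=> [//|M M1 W uW] /=; apply: le_trans (ltW M1).
  by rewrite -lecR; apply: le_trans (normc_ge_Im _) (le1 _ uW).
Qed.

Hypothesis haar_mu : normalized_haar mu.

Lemma preimage_unitary_group (V : 'M[R[i]]_d) : V \is unitarymx ->
  (fun W : 'M[R[i]]_d => V *m W) @^-1` @unitary_group R d = @unitary_group R d.
Proof.
move=> uV; apply/seteqP; split=> W /=; last exact: mul_unitarymx.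
move=> uVW; have /unitarymxP VV := uV.
have uW : V ^t* *m (V *m W) \is unitarymx.
  by apply: mul_unitarymx uVW; rewrite trmxC_unitary.
by move: uW; rewrite mulmxA (mulmx1C VV) mul1mx.
Qed.

(** Change of variables: by invariance, [mu] and its pushforward under [V] agree on the measurable
    subsets of the unitary group. *)
Lemma haar_Rintegral_mulmx (V : 'M[R[i]]_d) (f : borel_mx R d -> R) :
  V \is unitarymx -> measurable_fun setT f ->
  mu.-integrable (@unitary_group R d)
    (EFin \o (fun W : 'M[R[i]]_d => f (V *m W))) ->
  \int[mu]_(W in @unitary_group R d) f ((V : 'M[R[i]]_d) *m W) =
  \int[mu]_(W in @unitary_group R d) f W.
Proof.
move=> uV mf fi; congr fine.
have mV := measurable_mulmx V.
transitivity (\int[pushforward mu (mulmx V : borel_mx R d -> borel_mx R d)]_(W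
  in @unitary_group R d) (f W)%:E)%E.
  rewrite (integral_pushforward mV) ?preimage_unitary_group//.
  - exact/measurable_EFinP.
  - exact: measurable_unitary_group.
apply: eq_measure_integral => A mA AU /=.
(* The pushforward takes preimages while invariance speaks of direct images: the preimage under [V]
   is the image under the inverse [V ^t*], so invariance is applied to [V ^t*]. *)
rewrite /pushforward -[RHS](haar_mu.2 (V ^t*)) ?trmxC_unitary//.
have VV : V *m V ^t* = 1%:M by exact/unitarymxP.
congr (mu _); apply/seteqP; split=> [W AW|_ [X AX <-]].
  exists (V *m W) => //; rewrite mulmxA.
  by rewrite (mulmx1C VV) mul1mx.
by rewrite /preimage/= mulmxA VV mul1mx.
Qed.

Lemma haar_cintegral_mulmx (V : 'M[R[i]]_d) (f : 'M[R[i]]_d -> R[i]) :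
  V \is unitarymx ->
  measurable_fun [set: borel_mx R d] (fun W => complex.Re (f W)) ->
  measurable_fun [set: borel_mx R d] (fun W => complex.Im (f W)) ->
  cintegrable mu (@unitary_group R d) (fun W => f (V *m W)) ->
  cintegral mu (@unitary_group R d) (fun W => f (V *m W)) =
  cintegral mu (@unitary_group R d) f.
Proof.
move=> uV mRe mIm [fRe fIm]; congr (_ +i* _).
  exact: (haar_Rintegral_mulmx uV mRe).
exact: (haar_Rintegral_mulmx uV mIm).
Qed.

Let E (i j k l : 'I_d) : R[i] :=
  cintegral mu (@unitary_group R d) (entry_prod i j k l).

(** Meant for a [V] that permutes or rescales rows: the row indices may change, the column indices
    stay, and [c] collects the scalars. *)
Lemma haar_entry_prod_mulmx (V : 'M[R[i]]_d) (c : R[i]) (i j k l i' k' : 'I_d) :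
  V \is unitarymx ->
  (forall W, entry_prod i j k l (V *m W) = c * entry_prod i' j k' l W) ->
  E i j k l = c * E i' j k' l.
Proof.
move=> uV VW; have ci := cintegrable_entry_prod i' j k' l.
rewrite /E -(haar_cintegral_mulmx uV (measurable_Re_entry_prod _ _ _ _)
  (measurable_Im_entry_prod _ _ _ _)).
  by rewrite -cintegralZ//; [apply: eq_cintegral => W _|
     exact: measurable_unitary_group].
rewrite (_ : (fun _ => _) = fun W => c * entry_prod i' j k' l W); last first.
  exact/funext.
by apply: cintegrableZ => //; exact: measurable_unitary_group.
Qed.

Lemma haar_entry_prod_neq (i j k l : 'I_d) : i != k -> E i j k l = 0.
Proof.
move=> ik; pose D : 'M[R[i]]_d := diag_mx (\row_m (-1) ^+ (m == i)).
have uD : D \is unitarymx.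
  (* The diagonal entries are real signs, so each times its conjugate is 1. *)
  apply/unitarymxP; rewrite tr_diag_mx map_diag_mx mulmx_diag.
  apply/matrixP => a b; rewrite !mxE rmorphXn rmorphN1 -expr2 -exprM mulnC.
  by rewrite exprM sqrrN !expr1n.
have /eqP : E i j k l = -1 * E i j k l.
  apply: (haar_entry_prod_mulmx uD) => W.
  rewrite /entry_prod mul_diag_mx !mxE eqxx eq_sym (negbTE ik).
  by rewrite expr0 expr1 mul1r mulrA.
(* A number equal to its opposite vanishes in characteristic 0. *)
by rewrite mulN1r -addr_eq0 -mulr2n mulrn_eq0 => /eqP.
Qed.

Lemma haar_entry_prod_diag (i j k l : 'I_d) : E i j i l = E k j k l.
Proof.
pose P : 'M[R[i]]_d := perm_mx (perm.tperm i k).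
have uP : P \is unitarymx.
  (* A permutation matrix is real, and a transposition is its own inverse. *)
  apply/unitarymxP; rewrite tr_perm_mx map_perm_mx.
  by rewrite -perm_mxM perm.tpermV perm.tperm2 perm_mx1.
rewrite (@haar_entry_prod_mulmx P 1 i j i l k k)// ?mul1r// => W.
by rewrite /entry_prod -row_permE !mxE perm.tpermL mul1r.
Qed.

Lemma sum_haar_entry_prod (j l : 'I_d) :
  \sum_i E i j i l = (j == l)%:R.
Proof.
have mU := measurable_unitary_group.
rewrite -cintegral_sum//; last by move=> i; exact: cintegrable_entry_prod.
transitivity (cintegral mu (@unitary_group R d) (fun=> (j == l)%:R)).
  (* Unitarity is given as [W *m W ^t* = 1]; [mulmx1C] turns it into [W ^t* *m W = 1],
     orthonormality of the columns. *)
  apply: eq_cintegral => W /set_mem/unitarymxP/mulmx1C/matrixP/(_ l j).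
  rewrite !mxE eq_sym => <-; apply: eq_bigr => i _.
  by rewrite !mxE mulrC.
rewrite /cintegral !Rintegral_cst//.
rewrite [X in fine X](_ : _ = 1%E); last exact: haar_mu.1.
by case: (j == l); rewrite /= !mulr1.
Qed.

Lemma haar_entry_prod (i j k l : 'I_d) :
  E i j k l = ((i == k) && (j == l))%:R / d%:R.
Proof.
have [<-|ik] := eqVneq i k; last by rewrite haar_entry_prod_neq// mul0r.
(* The index [i] witnesses that [d] is positive. *)
have d0 : (d%:R : R[i]) != 0.
  by rewrite pnatr_eq0 -lt0n (leq_ltn_trans _ (ltn_ord i)).
apply: (mulIf d0); rewrite divfK// -sum_haar_entry_prod.
(* All [d] terms of the sum equal the moment sought, so the sum is [d] times that moment. *)
rewrite (eq_bigr (fun=> E i j i l)) => [|m _]; last exact: haar_entry_prod_diag.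
by rewrite sumr_const card_ord mulr_natr.
Qed.

End haar.

(** * Traces as polynomials in the matrix entries *)

Lemma mxtrace_mul_pair (R : comNzRingType) (d : nat) (N M : 'M[R]_d) :
  \tr (N *m M) = \sum_(p : 'I_d * 'I_d) M p.2 p.1 * N p.1 p.2.
Proof.
rewrite -(pair_bigA _ (fun i j => M j i * N i j)) /=.
apply: eq_bigr => i _; rewrite mxE; apply: eq_bigr => j _; exact: mulrC.
Qed.

Section trace_mpoly.
Variables (R : comNzRingType) (d n : nat) (s : 'I_(d * d) -> 'I_n).

(** A linear form in the block of variables selected by [s]: [lshift] for the entries of the matrix,
    [rshift] for those of its adjoint. Using [mxvec_index] matches the order in which [eval_adj]
    lists them. *)
Definition trace_mpoly (M : 'M[R]_d) : mpoly n R :=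
  \sum_(p : 'I_d * 'I_d) M p.2 p.1 *: mpolyX R (mnm1 (s (mxvec_index p.1 p.2))).

Lemma meval_trace_mpoly (M N : 'M[R]_d) (v : 'I_n -> R) :
  (forall i j, v (s (mxvec_index i j)) = N i j) ->
  meval v (trace_mpoly M) = \tr (N *m M).
Proof.
move=> vN; rewrite mxtrace_mul_pair raddf_sum; apply: eq_bigr => p _ /=.
by rewrite mevalZ mevalXU vN.
Qed.

Lemma msupp_trace_mpoly (M : 'M[R]_d) (m : multinom n) :
  m \in msupp (trace_mpoly M) -> exists k, m = mnm1 (s k).
Proof.
move=> /msupp_sum_le/flattenP[_ /mapP[p _ ->] /msuppZ_le].
by rewrite msuppX inE => /eqP ->; exists (mxvec_index p.1 p.2).
Qed.

End trace_mpoly.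

(** The degree of a single variable within its own block: injectivity ensures that it is counted
    exactly once. *)
Lemma sum_mnm1_inj (m n : nat) (s : 'I_m -> 'I_n) (k : 'I_m) :
  injective s -> \sum_(l < m) (mnm1 (s k) (s l)) = 1%N.
Proof.
move=> s_inj; rewrite (bigD1 k)//= mnm1E eqxx big1 ?addn0// => l lk.
by rewrite mnm1E inj_eq// eq_sym (negbTE lk).
Qed.

(** * The product of the two traces *)

Section two_trace.
Variables (R : realType) (d : nat) (C D : 'M[R[i]]_d).

Let P : mpoly (d * d + d * d) R[i] :=
  trace_mpoly (@lshift (d * d) (d * d)) C *
  trace_mpoly (@rshift (d * d) (d * d)) D.

(** Each factor is a linear form in its own block, so every monomial of [P] is one left variable
    times one right variable, of bidegree (1, 1). *)
Lemma bidegree_le_two_trace t : (1 <= t)%N -> bidegree_le t P.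
Proof.
move=> t1 m /msuppM_le/allpairsP[[m1 m2] /= []].
move=> /msupp_trace_mpoly[k ->] /msupp_trace_mpoly[l ->] ->.
split; under eq_bigr do rewrite mnmDE.
  rewrite big_split /= sum_mnm1_inj; last exact: lshift_inj.
  by rewrite big1 ?addn0// => h _; rewrite mnm1E eq_rlshift.
rewrite big_split /= addnC sum_mnm1_inj; last exact: rshift_inj.
by rewrite big1 ?addn0// => h _; rewrite mnm1E eq_lrshift.
Qed.

Lemma eval_adj_two_trace (W : 'M[R[i]]_d) :
  eval_adj P W = \tr (W *m C) * \tr (W ^t* *m D).
Proof.
rewrite /eval_adj mevalM; congr (_ * _); apply: meval_trace_mpoly => i j.
  by rewrite row_mxEl mxvecE.
by rewrite row_mxEr mxvecE.
Qed.

(** The components of [q] appear swapped because the entry [(q.1, q.2)] of the adjoint is the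
    conjugate of [W q.2 q.1]. *)
Lemma two_traceE (W : 'M[R[i]]_d) : \tr (W *m C) * \tr (W ^t* *m D) =
  \sum_(p : 'I_d * 'I_d) \sum_(q : 'I_d * 'I_d)
    C p.2 p.1 * D q.2 q.1 * entry_prod p.1 p.2 q.2 q.1 W.
Proof.
rewrite !mxtrace_mul_pair big_distrl; apply: eq_bigr => p _ /=.
rewrite big_distrr; apply: eq_bigr => q _ /=.
by rewrite !mxE mulrACA.
Qed.

Lemma haar_two_trace (mu : probability (borel_mx R d) R) :
  normalized_haar mu ->
  cintegral mu (@unitary_group R d)
    (fun W : 'M[R[i]]_d => \tr (W *m C) * \tr (W ^t* *m D)) =
  d%:R^-1 * \tr (C *m D).
Proof.
move=> haar_mu; have mU := @measurable_unitary_group R d.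
have ci p q : cintegrable mu (@unitary_group R d)
    (fun W => C p.2 p.1 * D q.2 q.1 * entry_prod p.1 p.2 q.2 q.1 W).
  by apply: cintegrableZ => //; exact: cintegrable_entry_prod.
under eq_fun do rewrite two_traceE.
rewrite cintegral_sum//; last by move=> p; exact: cintegrable_sum.
(* After cyclicity the right-hand trace is the sum over [p] of [C p.2 p.1 * D p.1 p.2], to be
   matched term by term. *)
rewrite mxtrace_mulC mxtrace_mul_pair mulr_sumr; apply: eq_bigr => p _.
rewrite cintegral_sum//; under eq_bigr => q _.
  rewrite cintegralZ//; last exact: cintegrable_entry_prod.
  rewrite haar_entry_prod//.
  over.
(* The moment is nonzero only if [p.1 = q.2] and [p.2 = q.1], which leaves the single index
   [q = (p.2, p.1)]. *)
rewrite (bigD1 (p.2, p.1))//= !eqxx big1 => [|[k l] /=].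
  by rewrite addr0 mul1r mulrC.
rewrite xpair_eqE negb_and => /orP[] h.
  by rewrite (eq_sym p.2) (negbTE h) andbF mul0r mulr0.
by rewrite (eq_sym p.1) (negbTE h) mul0r mulr0.
Qed.

End two_trace.

Theorem lemma1 (R : realType) (d t : nat) (mu nu : probability (borel_mx R d) R)
    (S : set (borel_mx R d)) (C D : 'M[R[i]]_d) :
  (0 < d)%N -> (1 <= t)%N ->
  normalized_haar mu ->
  S `<=` @unitary_group R d -> measurable S ->
  uniform_on nu S ->
  unitary_design t mu nu S ->
  cintegral nu S (fun W : 'M[R[i]]_d => \tr (W *m C) * \tr (W ^t* *m D)) =
    cintegral mu (@unitary_group R d)
      (fun W : 'M[R[i]]_d => \tr (W *m C) * \tr (W ^t* *m D)) /\
  cintegral mu (@unitary_group R d)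
      (fun W : 'M[R[i]]_d => \tr (W *m C) * \tr (W ^t* *m D)) =
    (d%:R)^-1 * \tr (C *m D).
Proof.
move=> _ t1 haar_mu _ _ _ design; split; last exact: haar_two_trace.
(* The design property is applied to the polynomial whose value at [W] is the product of the two
   traces; its bidegree is at most [t] since [t] is at least 1. *)
have := design _ (@bidegree_le_two_trace R d C D t t1).
rewrite (_ : eval_adj _ = fun W => \tr (W *m C) * \tr (W ^t* *m D))//.
by apply/funext => W; exact: eval_adj_two_trace.
Qed.
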